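(* Let $k$ be an integer with $1\le k\le n-1$, let $s$ be a positive integer with $\gcd(s,n)=1$, and let $L=\sum_{i=0}^{n-1}\eta_i x^{q^{si}}\in\mathscr{L}_{n,q}[x]\setminus\{0\}$. Then the Delsarte dual code of $\mathcal{H}_{k,s}(x,L(x))$ is equivalent to $\mathcal{H}_{n-k,s}(x,-\hat{L}(x))$, where $\hat{L}$ is the adjoint of $L$.
   Context: Let $q=p^\lambda$ be a power of a prime $p$, and $n$ a positive integer. $\mathscr{L}_{n,q}[x]$ denotes the set of linearized polynomials $\sum_i a_i x^{q^i}$, $a_i\in\mathbb{F}_{q^n}$, modulo $x^{q^n}-x$; it is identified with the set of $\mathbb{F}_q$-linear maps $\mathbb{F}_{q^n}\to\mathbb{F}_{q^n}$. Exponents $q^j$ of $x$ are read with $j$ modulo $n$. For $L_1,L_2\in\mathscr{L}_{n,q}[x]$ and $s$ coprime to $n$, define the code $$\mathcal{H}_{k,s}(L_1,L_2)=\{L_1(a_0)x+a_1x^{q^s}+\cdots+a_{k-1}x^{q^{s(k-1)}}+L_2(a_0)x^{q^{sk}}: a_0,\dots,a_{k-1}\in\mathbb{F}_{q^n}\}\subseteq\mathscr{L}_{n,q}[x];$$ $\mathcal{H}_{k,s}(x,L(x))$ is the case $L_1(x)=x$, $L_2=L$. The adjoint of $f=\sum_{i=0}^{n-1}a_ix^{q^{si}}$ is $\hat f=\sum_{i=0}^{n-1}a_i^{q^{s(n-i)}}x^{q^{s(n-i)}}$. The Delsarte dual of a code $\mathcal{C}\subseteq\mathscr{L}_{n,q}[x]$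 is $\mathcal{C}^\perp=\{g\in\mathscr{L}_{n,q}[x]: b(f,g)=0\text{ for all }f\in\mathcal{C}\}$, where $b(f,g)=\sum_{i=0}^{n-1}\mathrm{Tr}_{q^n/q}(a_ib_i)$ for $f=\sum_{i=0}^{n-1} a_ix^{q^i}$, $g=\sum_{i=0}^{n-1} b_ix^{q^i}$, and $\mathrm{Tr}_{q^n/q}(x)=x+x^q+\cdots+x^{q^{n-1}}$. Two additive codes $\mathcal{C},\mathcal{C}'\subseteq\mathscr{L}_{n,q}[x]$ are equivalent if there exist bijective $\phi_1,\phi_2\in\mathscr{L}_{n,q}[x]$ and $\rho\in\mathrm{Aut}(\mathbb{F}_{q^n})$ such that $\mathcal{C}'=\{\phi_1\circ f^\rho\circ\phi_2: f\in\mathcal{C}\}$, where $f^\rho=\sum \rho(a_i)x^{q^i}$ for $f=\sum a_ix^{q^i}$. *)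

(* Defs.v *)
From HB Require Import structures.
From mathcomp Require Import all_boot all_order all_algebra.
Set Implicit Arguments.
Unset Strict Implicit.
Unset Printing Implicit Defensive.
Import GRing.Theory.
Local Open Scope ring_scope.

(* Throughout, F plays the role of the field with q ^ n elements. A class of
   linearized polynomials modulo X^(q^n) - X is represented by its reduced
   representative in {poly F}, i.e. a combination of X^(q^i) with i < n, and a
   code is a predicate on {poly F}. *)

Definition qX (F : finFieldType) (q n j : nat) : {poly F} :=
  'X^(q ^ (j %% n))%N.

Definition linearized (F : finFieldType) (q n : nat) (f : {poly F}) : Prop :=
  exists a : 'I_n -> F, f = \sum_(i < n) a i *: qX F q n i.

Definition qcoef (F : finFieldType) (q n : nat) (f : {poly F}) (j : nat) : F :=
  f`_(q ^ (j %% n))%N.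

Definition qcomp (F : finFieldType) (q n : nat) (f g : {poly F}) : {poly F} :=
  (f \Po g) %% ('X^(q ^ n)%N - 'X).

Definition code_H (F : finFieldType) (q n k s : nat) (L1 L2 : {poly F})
    (f : {poly F}) : Prop :=
  exists a : nat -> F,
    f = L1.[a 0%N] *: 'X
        + \sum_(1 <= i < k) a i *: qX F q n (s * i)
        + L2.[a 0%N] *: qX F q n (s * k).

(* For s coprime to n, qcoef q n f (s * i) is the coefficient a_i in
   f = \sum_(i < n) a_i X^(q^(s i)). *)
Definition adjoint (F : finFieldType) (q n s : nat) (f : {poly F}) : {poly F} :=
  \sum_(i < n)
    (qcoef q n f (s * i) ^+ (q ^ (s * (n - i)))%N) *: qX F q n (s * (n - i)).

Definition trq (F : finFieldType) (q n : nat) (x : F) : F :=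
  \sum_(j < n) x ^+ (q ^ j)%N.

Definition bform (F : finFieldType) (q n : nat) (f g : {poly F}) : F :=
  \sum_(i < n) trq q n (qcoef q n f i * qcoef q n g i).

Definition delsarte_dual (F : finFieldType) (q n : nat)
    (C : {poly F} -> Prop) (g : {poly F}) : Prop :=
  linearized q n g /\ forall f : {poly F}, C f -> bform q n f g = 0.

Definition code_equiv (F : finFieldType) (q n : nat)
    (C C' : {poly F} -> Prop) : Prop :=
  exists (phi1 phi2 : {poly F}) (rho : {rmorphism F -> F}),
    [/\ linearized q n phi1 /\ bijective (horner phi1),
        linearized q n phi2 /\ bijective (horner phi2),
        bijective rho
      & forall g : {poly F},
          C' g <-> exists2 f, C f
                   & g = qcomp q n phi1 (qcomp q n (map_poly rho f) phi2)].

(* Main.v *)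
(** Index a linearized polynomial by its coefficients [c i] at [X^(q^(s i))],
    which is harmless since [s] is invertible modulo [n].  A word of
    [H_(k,s)(x, L)] has [c k = L (c 0)] and [c i = 0] for [i > k].  Since the
    trace form is nondegenerate and [Tr (L x * y) = Tr (x * L^ y)] for the
    adjoint [L^], the words [b] of the dual are those with [b 0 = - L^ (b k)]
    and [b i = 0] for [0 < i < k].  Composing on the right with
    [X^(q^(s (n - k)))] shifts indices cyclically, moving [b k] to position [0]
    and [b 0] to position [n - k], which gives exactly [H_(n-k,s)(x, - L^)]. *)
Require Import Defs.
From HB Require Import structures.
From mathcomp Require Import all_boot all_order all_algebra finfield.
Set Implicit Arguments.
Unset Strict Implicit.
Unset Printing Implicit Defensive.
Import GRing.Theory.
Local Open Scope ring_scope.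

(** * Reindexing sums over residues modulo [n] *)

Lemma sum_ord_modn (V : nmodType) (n : nat) (h : nat -> nat) (G : nat -> V) :
    (0 < n)%N ->
    (forall i j, (i < n)%N -> (j < n)%N -> h i = h j %[mod n] -> i = j) ->
  \sum_(i < n) G i = \sum_(i < n) G (h i %% n)%N.
Proof.
case: n => // n _ h_inj.
have sigma_inj : injective (fun i : 'I_n.+1 => inord (h i %% n.+1) : 'I_n.+1).
  move=> i j /(congr1 val); rewrite /= !inordK ?ltn_pmod // => hij.
  exact/val_inj/(h_inj _ _ (ltn_ord i) (ltn_ord j) hij).
rewrite (reindex_inj sigma_inj); apply: eq_bigr => i _.
by rewrite inordK ?ltn_pmod.
Qed.

Lemma sum_ord_addn_modn (V : nmodType) (n m : nat) (G : nat -> V) :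
  (0 < n)%N -> \sum_(i < n) G i = \sum_(i < n) G ((i + m) %% n)%N.
Proof.
move=> n_gt0; apply: (@sum_ord_modn _ _ (addn^~ m)) => // i j ltin ltjn /eqP.
by rewrite eqn_modDr !modn_small // => /eqP.
Qed.

Lemma sum_ord_two (V : nmodType) (n k : nat) (G : nat -> V) :
    (0 < k < n)%N -> (forall i, (0 < i < n)%N -> i != k -> G i = 0) ->
  \sum_(i < n) G i = G 0%N + G k.
Proof.
case/andP=> k_gt0 ltkn G0; have n_gt0 := ltn_trans k_gt0 ltkn.
rewrite (bigD1 (Ordinal n_gt0)) // (bigD1 (Ordinal ltkn)) /=; last first.
  by rewrite -(inj_eq val_inj) /= -lt0n.
rewrite big1 ?addr0 // => i /andP[i_neq0 i_neqk].
by apply: G0 => //; rewrite ltn_ord andbT lt0n.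
Qed.

Section LinearizedPolynomials.

Variables (q n s : nat) (F : finFieldType).
Hypotheses (q_pchar : [pchar F].-nat q) (q_gt1 : (1 < q)%N).
Hypotheses (n_gt0 : (0 < n)%N) (cardF : #|F| = (q ^ n)%N).
Hypothesis s_coprime : coprime s n.

(** * Frobenius powers and the trace form *)

Let expq_gt0 m : (0 < q ^ m)%N.
Proof. by rewrite expn_gt0 ltnW. Qed.

Lemma expq_modn (x : F) m : x ^+ (q ^ (m %% n)) = x ^+ (q ^ m).
Proof.
have iter_q d r : x ^+ (q ^ (d * n + r)) = x ^+ (q ^ r).
  elim: d => [//|d IHd].
  by rewrite mulSn -addnA expnD exprM -cardF expf_card.
by rewrite {2}(divn_eq m n) iter_q.
Qed.

Lemma exprqD m (x y : F) :
  (x + y) ^+ (q ^ m) = x ^+ (q ^ m) + y ^+ (q ^ m).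
Proof. by rewrite exprDn_pchar // pnatX q_pchar. Qed.

Lemma trqD (x y : F) : trq q n (x + y) = trq q n x + trq q n y.
Proof. by rewrite -big_split; apply: eq_bigr => j _; rewrite exprqD. Qed.

Lemma trq0 : trq q n (0 : F) = 0.
Proof. by apply: big1 => j _; rewrite expr0n -leqn0 leqNgt expq_gt0. Qed.

Lemma trq_sum (G : 'I_n -> F) :
  trq q n (\sum_(i < n) G i) = \sum_(i < n) trq q n (G i).
Proof. exact: (big_morph _ trqD trq0). Qed.

(** Raising to the power [q ^ m] permutes the summands of the trace cyclically, because
    [x ^+ (q ^ n) = x]. *)
Lemma trq_expq m (x : F) : trq q n (x ^+ (q ^ m)) = trq q n x.
Proof.
rewrite /trq (sum_ord_addn_modn m (fun j => x ^+ (q ^ j))) //.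
by apply: eq_bigr => j _; rewrite expq_modn addnC expnD exprM.
Qed.

(** If [y] were nonzero, its multiples would fill [F] and the trace would vanish on all [q ^ n]
    elements, too many roots for a nonzero polynomial of degree below [q ^ n]. *)
Lemma trq_nondegenerate (y : F) : (forall x, trq q n (x * y) = 0) -> y = 0.
Proof.
move=> tr0; apply/eqP; apply: contraT => y_neq0.
pose T : {poly F} := \sum_(j < n) 'X^(q ^ j).
have trT x : T.[x] = trq q n x.
  by rewrite horner_sum; apply: eq_bigr => j _; rewrite hornerXn.
have T_neq0 : T != 0.
  (* The coefficient of [T] at degree 1 is 1: among the exponents [q ^ j] only [j = 0] gives 1. *)
  apply/eqP => /(congr1 (fun P : {poly F} => P`_1)); rewrite coef0 coef_sum.
  rewrite (bigD1 (Ordinal n_gt0)) //= coefXn expn0 eqxx big1 ?addr0.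
    by move/eqP; rewrite oner_eq0.
  move=> j; rewrite -(inj_eq val_inj) /= => j_neq0.
  by rewrite coefXn -[X in X == _](expn0 q) eqn_exp2l // eq_sym (negPf j_neq0).
have T_roots : all (root T) (enum F).
  apply/allP => z _; rewrite rootE trT -[z](divfK y_neq0).
  by rewrite tr0.
have := max_poly_roots T_neq0 T_roots (enum_uniq _).
rewrite -cardE cardF ltnNge => /negP[].
apply: leq_trans (size_sum _ _ _) _; apply/bigmax_leqP => j _.
by rewrite size_polyXn ltn_exp2l.
Qed.

(** * Linearized polynomials indexed by multiples of [s] *)

Lemma qX_eqmod i j : i = j %[mod n] -> qX F q n i = qX F q n j.
Proof. by rewrite /qX => ->. Qed.

Lemma horner_qX j (x : F) : (qX F q n j).[x] = x ^+ (q ^ j).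
Proof. by rewrite hornerXn expq_modn. Qed.

Lemma qX_modp m : 'X^(q ^ m) %% ('X^(q ^ n) - 'X) = qX F q n m.
Proof.
have size_mod : size ('X^(q ^ n) - 'X : {poly F}) = (q ^ n).+1.
  by rewrite size_polyDl ?size_polyXn ?size_polyN ?size_polyX // ltnS -cardF finRing_gt1.
rewrite {1}(divn_eq m n) /qX; elim: (m %/ n)%N => [|d IHd].
  by rewrite modp_small // size_mod size_polyXn ltnS ltn_exp2l // ltn_pmod.
(* One block of [n] is removed from the exponent: [u ^+ m - v ^+ m] is a multiple of [u - v], here
   with [u = 'X^(q ^ n)] and [v = 'X]. *)
rewrite mulSn -addnA expnD exprM -IHd -[X in X %% _](subrK 'X^(q ^ (d * n + m %% n))).
by rewrite modpD modp_eq0 ?add0r // subrXX dvdp_mulIl.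
Qed.

(** In this numbering the coefficients constrained by a code and by its dual form intervals of
    indices; only the values of [c] below [n] matter. *)
Definition slin (c : nat -> F) : {poly F} :=
  \sum_(i < n) c i *: qX F q n (s * i).

Lemma muls_modn_inj i j :
  (i < n)%N -> (j < n)%N -> (s * i)%N = (s * j)%N %[mod n] -> i = j.
Proof.
wlog leij : i j / (i <= j)%N.
  move=> W ltin ltjn eqij; case/orP: (leq_total i j) => /W; first exact.
  by move=> ->.
move=> ltin ltjn /esym/eqP; rewrite eqn_mod_dvd ?leq_mul2l ?leij ?orbT //.
rewrite -mulnBr Gauss_dvdr 1?coprime_sym // => n_dvd.
have: (j - i == 0)%N.
  by apply: contraLR n_dvd; rewrite -lt0n => ?; rewrite gtnNdvd // (leq_ltn_trans _ ltjn) ?leq_subr.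
by rewrite subn_eq0 => leji; apply/eqP; rewrite eqn_leq leij.
Qed.

Lemma sum_ord_muls_modn (V : nmodType) (G : nat -> V) :
  \sum_(i < n) G i = \sum_(i < n) G ((s * i) %% n)%N.
Proof. exact: sum_ord_modn muls_modn_inj. Qed.

Lemma eq_slin c d : (forall i, (i < n)%N -> c i = d i) -> slin c = slin d.
Proof. by move=> eq_cd; apply: eq_bigr => i _; rewrite eq_cd. Qed.

Lemma qcoef_slin c j : (j < n)%N -> qcoef q n (slin c) (s * j) = c j.
Proof.
move=> ltjn; rewrite /qcoef coef_sum (bigD1 (Ordinal ltjn)) //= big1 => [|i i_neqj].
  by rewrite coefZ coefXn eqxx mulr1 addr0.
rewrite coefZ coefXn eqn_exp2l //; case: eqP => [eq_ij|]; last by rewrite mulr0.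
by case/eqP: i_neqj; apply/val_inj/(muls_modn_inj (ltn_ord i) ltjn)/esym.
Qed.

Lemma linearizedP f : linearized q n f <-> exists c, f = slin c.
Proof.
split=> [[a ->]|[c ->]].
  (* [b] extends [a] by 0 to all naturals, so that the sum can be reindexed by the permutation
     [i -> s * i] of the residues. *)
  pose b i := oapp a 0 (insub i); exists (fun i => b ((s * i) %% n)%N).
  transitivity (\sum_(i < n) b i *: qX F q n i).
    by apply: eq_bigr => i _; rewrite /b valK.
  rewrite (sum_ord_muls_modn (fun i => b i *: qX F q n i)).
  by apply: eq_bigr => i _; rewrite (qX_eqmod (modn_mod _ _)).
exists (fun i => qcoef q n (slin c) i).
rewrite (sum_ord_muls_modn (fun i => qcoef q n (slin c) i *: qX F q n i)).
apply: eq_bigr => i _; rewrite (qX_eqmod (modn_mod _ _)).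
by rewrite /qcoef modn_mod -/(qcoef _ _ _ _) qcoef_slin.
Qed.

Lemma linearized_qX j : linearized q n (qX F q n j).
Proof.
have ltjn : (j %% n < n)%N by rewrite ltn_pmod.
exists (fun i : 'I_n => (val i == j %% n)%N%:R).
rewrite (bigD1 (Ordinal ltjn)) //= eqxx scale1r big1 => [|i].
  by rewrite addr0; apply/esym/qX_eqmod/modn_mod.
by rewrite -(inj_eq val_inj) /= => /negPf->; rewrite scale0r.
Qed.

Lemma bijective_horner_qX j : bijective (horner (qX F q n j)).
Proof.
have ltjn : (j %% n < n)%N by rewrite ltn_pmod.
exists (horner (qX F q n (n - j %% n))) => x;
  rewrite !horner_qX -exprM -expnD -expq_modn ?[(j + _)%N]addnC -modnDmr;
  by rewrite subnK ?modnn ?expr1 // ltnW.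
Qed.

(** * The bilinear form and the adjoint *)

Lemma bform_slin a b :
  bform q n (slin a) (slin b) = \sum_(i < n) trq q n (a i * b i).
Proof.
rewrite /bform (sum_ord_muls_modn
  (fun i => trq q n (qcoef q n (slin a) i * qcoef q n (slin b) i))).
apply: eq_bigr => i _; rewrite /qcoef modn_mod -!/(qcoef _ _ _ _).
by rewrite !qcoef_slin.
Qed.

Lemma horner_slin c x : (slin c).[x] = \sum_(i < n) c i * x ^+ (q ^ (s * i)).
Proof.
by rewrite horner_sum; apply: eq_bigr => i _; rewrite hornerZ horner_qX.
Qed.

Lemma horner_adjoint_slin c y :
  (adjoint q n s (slin c)).[y]
    = \sum_(i < n) (c i * y) ^+ (q ^ (s * (n - i))).
Proof.
rewrite horner_sum; apply: eq_bigr => i _.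
by rewrite hornerZ horner_qX qcoef_slin // exprMn.
Qed.

(** The two sides agree term by term: the power [q ^ (s * i)] preserves the trace and undoes the
    power [q ^ (s * (n - i))] in the adjoint, since together they give [q ^ (s * n)], which fixes
    [F]. *)
Lemma trq_adjoint c x y :
  trq q n ((slin c).[x] * y) = trq q n (x * (adjoint q n s (slin c)).[y]).
Proof.
rewrite horner_slin horner_adjoint_slin mulr_suml mulr_sumr !trq_sum.
apply: eq_bigr => i _; rewrite -[RHS](trq_expq (s * i)) exprMn -exprM -expnD.
rewrite -mulnDr subnK 1?ltnW // -(expq_modn _ (s * n)) modnMl expr1.
by rewrite -mulrA mulrCA.
Qed.

(** * Composition and cyclic shift of coefficients *)

Lemma modp_sum (d : {poly F}) (G : 'I_n -> {poly F}) :
  (\sum_(i < n) G i) %% d = \sum_(i < n) G i %% d.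
Proof. exact: (big_morph _ (fun x y => modpD d x y) (mod0p d)). Qed.

Lemma qcompX (f : {poly F}) : linearized q n f -> qcomp q n 'X f = f.
Proof.
case/linearizedP=> c ->; rewrite /qcomp comp_polyX modp_sum.
by apply: eq_bigr => i _; rewrite modpZl qX_modp (qX_eqmod (modn_mod _ _)).
Qed.

(** Substitution moves index [i] to [i + (n - k)], that is to [i - k] modulo [n]; hence position [i]
    receives the old coefficient at [i + k]. *)
Lemma qcomp_slin_qX b k :
    (k <= n)%N ->
  qcomp q n (slin b) (qX F q n (s * (n - k)))
    = slin (fun i => b ((i + k) %% n)%N).
Proof.
move=> lekn; rewrite /qcomp raddf_sum modp_sum.
transitivity (\sum_(i < n) b i *: qX F q n (s * (i + (n - k)))).
  apply: eq_bigr => i _; rewrite /= comp_polyZ modpZl rmorphXn /= comp_polyX -exprM -expnD.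
  by rewrite qX_modp; congr (_ *: _); apply: qX_eqmod; rewrite modnDm -mulnDr addnC.
rewrite (sum_ord_addn_modn k (fun i => b i *: qX F q n (s * (i + (n - k))))) //.
apply: eq_bigr => i _; congr (_ *: _); apply: qX_eqmod.
by rewrite -modnMmr modnDml -addnA subnKC // modnDr modnMmr.
Qed.

(** * Coefficient descriptions of the code and of its dual *)

Lemma slin_split c k :
    (0 < k < n)%N -> (forall i, (k < i < n)%N -> c i = 0) ->
  slin c = c 0%N *: 'X + \sum_(1 <= i < k) c i *: qX F q n (s * i)
           + c k *: qX F q n (s * k).
Proof.
case/andP=> k_gt0 ltkn c0.
rewrite /slin -(big_mkord predT (fun i => c i *: qX F q n (s * i))).
rewrite (big_cat_nat (n := k.+1)) //= [X in _ + X](_ : _ = 0); last first.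
  by rewrite big_nat big1 // => i /c0->; rewrite scale0r.
rewrite addr0 big_nat_recr //= big_ltn //; congr (_ *: _ + _ + _).
by rewrite /qX muln0 mod0n.
Qed.

Lemma code_HP k (M f : {poly F}) :
    (0 < k < n)%N ->
  code_H q n k s 'X M f <->
  exists c, [/\ f = slin c, c k = M.[c 0%N]
              & forall i, (k < i < n)%N -> c i = 0].
Proof.
move=> k_range; have k_gt0 : (0 < k)%N by case/andP: k_range.
split=> [[a ->]|[c [-> ck c0]]]; last first.
  by exists c; rewrite (slin_split k_range c0) hornerX ck.
pose c i := if (i < k)%N then a i else if i == k then M.[a 0%N] else 0.
have c0 i : (k < i < n)%N -> c i = 0.
  by case/andP=> ltki _; rewrite /c ltnNge ltnW // gtn_eqF.
exists c; split => //; last by rewrite /c ltnn eqxx k_gt0.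
rewrite (slin_split k_range c0) hornerX /c ltnn eqxx k_gt0.
congr (_ + _ + _); apply: eq_big_nat => i /andP[_ ltik].
by rewrite ltik.
Qed.

Lemma delsarte_dual_code_HP k (M N g : {poly F}) :
    (0 < k < n)%N ->
    (forall x y, trq q n (M.[x] * y) = trq q n (x * N.[y])) ->
  delsarte_dual q n (code_H q n k s 'X M) g <->
  exists b, [/\ g = slin b, b 0%N = - N.[b k]
              & forall i, (0 < i < k)%N -> b i = 0].
Proof.
move=> k_range adjMN; have [k_gt0 ltkn] := andP k_range.
(* Ensures that a word supported at a single index strictly between 0 and [k] satisfies [c k =
   M.[c 0%N]]. *)
have M0 : M.[0] = 0.
  by apply: trq_nondegenerate => x; rewrite mulrC adjMN mul0r trq0.
split=> [[/linearizedP[b ->] dual_b]|[b [-> b0 b_mid]]].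
  exists b; split=> //.
    apply/eqP; rewrite -addr_eq0; apply/eqP/trq_nondegenerate => x.
    (* The codeword with [x] at 0 and its forced companion at [k]; orthogonality to it reads [trq q
       n (x * (b 0 + N.[b k])) = 0]. *)
    pose c i := if i == 0%N then x else if i == k then M.[x] else 0.
    have Hc : code_H q n k s 'X M (slin c).
      apply/code_HP => //; exists c; split=> [//||i /andP[ltki _]].
        by rewrite /c eqxx gtn_eqF.
      by rewrite /c gtn_eqF ?(ltn_trans k_gt0) // gtn_eqF.
    have := dual_b _ Hc; rewrite bform_slin.
    rewrite (@sum_ord_two _ _ k (fun i => trq q n (c i * b i))) //.
      by rewrite /c eqxx gtn_eqF // eqxx adjMN -trqD -mulrDr.
    move=> i /andP[i_gt0 _] /negPf i_neqk.
    by rewrite /c gtn_eqF // i_neqk mul0r trq0.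
  move=> i /andP[i_gt0 ltik]; apply: trq_nondegenerate => x.
  (* A codeword supported at the free index [i] isolates [b i]. *)
  pose c j := if j == i then x else 0.
  have Hc : code_H q n k s 'X M (slin c).
    apply/code_HP => //; exists c; split=> [//||j /andP[ltkj _]].
      by rewrite /c gtn_eqF // ltn_eqF // M0.
    by rewrite /c gtn_eqF // (ltn_trans ltik).
  have := dual_b _ Hc; rewrite bform_slin.
  rewrite (bigD1 (Ordinal (ltn_trans ltik ltkn))) //= /c eqxx big1 ?addr0 // => j.
  by rewrite -(inj_eq val_inj) /= => /negPf->; rewrite mul0r trq0.
split; first by apply/linearizedP; exists b.
move=> _ /(code_HP _ _ k_range)[c [-> ck c_top]]; rewrite bform_slin.
(* Away from 0 and [k] every product vanishes: [b] is zero below [k] and [c] is zero above it. *)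
rewrite (@sum_ord_two _ _ k (fun i => trq q n (c i * b i))) //.
  by rewrite ck adjMN -trqD -mulrDr b0 addNr mulr0 trq0.
move=> i /andP[i_gt0 ltin] i_neqk; case: (ltngtP i k) i_neqk => // [ltik|ltki] _.
  by rewrite b_mid ?i_gt0 // mulr0 trq0.
by rewrite c_top ?ltki // mul0r trq0.
Qed.

(** * The equivalence by a cyclic shift *)

Lemma delsarte_dual_equiv k c :
    (0 < k < n)%N ->
  code_equiv q n (delsarte_dual q n (code_H q n k s 'X (slin c)))
    (code_H q n (n - k) s 'X (- adjoint q n s (slin c))).
Proof.
move=> k_range; have [k_gt0 ltkn] := andP k_range; have lekn := ltnW ltkn.
have nk_range : (0 < n - k < n)%N by rewrite subn_gt0 ltkn ltn_subrL k_gt0.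
have X_qX : 'X = qX F q n 0 by rewrite /qX mod0n.
have dualP := delsarte_dual_code_HP _ k_range (trq_adjoint c).
exists 'X, (qX F q n (s * (n - k))), idfun.
(* With ['X] read as the Frobenius monomial of index 0, one pair of lemmas serves both outer
   maps. *)
split; rewrite ?X_qX;
  try (by split; [exact: linearized_qX | exact: bijective_horner_qX]).
  by exists id.
rewrite -X_qX => g.
have shiftE b : qcomp q n 'X (qcomp q n (map_poly idfun (slin b))
    (qX F q n (s * (n - k)))) = slin (fun i => b ((i + k) %% n)%N).
  rewrite map_poly_id // qcomp_slin_qX // qcompX //.
  by apply/linearizedP; exists (fun i => b ((i + k) %% n)%N).
split=> [/(code_HP _ _ nk_range)[d [-> d_nk d_top]]|[f]].
  (* The inverse shift: moving by [n - k] and then by [k] is the identity modulo [n]. *)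
  pose b i := d ((i + (n - k)) %% n)%N.
  exists (slin b).
    apply/dualP; exists b; split=> //.
      rewrite /b add0n subnKC // modnn modn_small; last by case/andP: nk_range.
      by rewrite d_nk hornerN.
    move=> i /andP[i_gt0 ltik].
    (* For [0 < i < k] the shifted index stays below [n] without wrapping and exceeds [n - k], where
       [d] vanishes. *)
    have lt_in : (i + (n - k) < n)%N by rewrite -{2}(subnKC lekn) ltn_add2r.
    by rewrite /b modn_small // d_top // lt_in andbT -{1}[(n - k)%N]add0n ltn_add2r.
  rewrite shiftE; apply: eq_slin => i ltin.
  by rewrite /b modnDml -addnA subnKC // modnDr modn_small.
case/dualP=> b [-> b0 b_mid] ->; rewrite shiftE.
apply/code_HP => //; exists (fun i => b ((i + k) %% n)%N); split=> //.
  by rewrite subnK // modnn add0n modn_small // b0 hornerN.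
(* For [n - k < i < n] the index [i + k] wraps once, to [i + k - n], which lies strictly between 0
   and [k], where [b] vanishes. *)
move=> i /andP[lti ltin]; have lt_n : (n < i + k)%N by rewrite addnC -ltn_subLR.
have lt_k : (i + k - n < k)%N by rewrite ltn_subLR ?ltn_add2r // ltnW.
rewrite -(subnK (ltnW lt_n)) modnDr modn_small ?(ltn_trans lt_k) //.
by apply: b_mid; rewrite subn_gt0 lt_n.
Qed.

End LinearizedPolynomials.

Theorem theorem4p2 (p lam q n k s : nat) (F : finFieldType)
    (p_prime : prime p) (lam_gt0 : (0 < lam)%N) (q_def : q = (p ^ lam)%N)
    (n_gt0 : (0 < n)%N) (cardF : #|F| = (q ^ n)%N)
    (k_range : (1 <= k <= n - 1)%N)
    (s_gt0 : (0 < s)%N) (s_coprime : coprime s n)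
    (eta : 'I_n -> F) (L : {poly F})
    (L_def : L = \sum_(i < n) eta i *: qX F q n (s * i)) (L_neq0 : L != 0) :
  code_equiv q n
    (delsarte_dual q n (code_H q n k s 'X L))
    (code_H q n (n - k) s 'X (- adjoint q n s L)).
Proof.
have q_gt1 : (1 < q)%N.
  by rewrite q_def -(exp1n lam) ltn_exp2r // prime_gt1.
have p_pchar : p \in [pchar F].
  by apply: (@card_finPcharP _ p (lam * n)) => //; rewrite cardF q_def expnM.
have q_pchar : [pchar F].-nat q.
  by rewrite (eq_pnat _ (pcharf_eq p_pchar)) q_def pnatX pnat_id.
have k_lt : (0 < k < n)%N.
  by case/andP: k_range => -> /=; rewrite -ltnS subn1 prednK.
(* [eta] is extended by 0 beyond the ordinals to fit the coefficient functions on naturals. *)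
have -> : L = slin q n s (fun i => oapp eta 0 (insub i)).
  by rewrite L_def; apply: eq_bigr => i _; rewrite valK.
exact: delsarte_dual_equiv.
Qed.
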